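(* Let $(P(\cdot),r(\cdot))$ be a feasible scheduler such that: (i) (constant rate) for every packet $i\in\{1,\dots,N\}$ there is a constant $r_i$ such that $r(t)=r_i$ for almost every $t$ with $P(t)=i$; (ii) (non-idling) $\sum_{i\in\mathcal F_j}\tau_{i,j}=|\mathcal E_j|$ for every $j=1,\dots,M$; (iii) for every $j=1,\dots,M$, with $\Psi_j=\{i\in\mathcal F_j:\tau_{i,j}>0\}$ and $\bar\Psi_j=\{i\in\mathcal F_j:\tau_{i,j}=0\}$: the rates $r_i$, $i\in\Psi_j$, are all equal, and $r_i\ge r_k$ for all $i\in\Psi_j$ and all $k\in\bar\Psi_j$. Then $(P(\cdot),r(\cdot))$ is optimal, i.e. it minimizes the transmission energy $E=\int_0^T f(r(t))\,dt$ among all feasible schedulers.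
   Context: Packets: there are $N$ packets; packet $i$ has size $B_i>0$, arrival instant $t_{a,i}$ and deadline $t_{d,i}>t_{a,i}$, with $0=t_{a,1}<t_{a,2}<\dots<t_{a,N}$. The deadlines are otherwise arbitrary (their order need not agree with the order of arrivals). Let $T=\max_i t_{d,i}$. The life time of packet $i$ is $\mathcal L_i=[t_{a,i},t_{d,i}]$. Epochs: let $0=t_0<t_1<\dots<t_M=T$ be the distinct values among all $t_{a,i},t_{d,i}$, in ascending order. Epoch $j$ is $\mathcal E_j=[t_{j-1},t_j]$, with length $|\mathcal E_j|=t_j-t_{j-1}$, $j=1,\dots,M$. Put $\mathcal F_j=\{i:\mathcal E_j\subseteq\mathcal L_i\}$ (packets that may be transmitted in epoch $j$). Power function: $f:[0,\infty)\to[0,\infty)$ is convex and increasing; transmitting at rate $r$ uses power $f(r)$. Schedulers: a scheduler consists of measurable functions on $[0,T]$: $P(t)\in\{1,\dots,N\}\cup\{\text{idle}\}$, the packet transmitted at time $t$ (at most one packet at a time), and $r(t)\ge 0$, the transmission rate, with $r(t)=0$ when $P(t)=\text{idle}$. It is feasible if each packet is transmitted only during its life time ($P(t)=i$ implies $t\in\mathcal L_i$) and completely: $\int_{\{t\in\mathcal L_i:\,P(t)=i\}} r(t)\,dt=B_i$ for every $i$. For a scheduler, $\tau_{i,j}$ denotes the Lebesgue measure of $\{t\in\mathcal E_j:P(t)=i\}$, the transmission time of packet $i$ in epoch $j$. *)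

(* Defs.v *)
From HB Require Import structures.
From mathcomp Require Import all_boot all_order all_algebra.
From mathcomp Require Import all_classical all_reals all_analysis.

Set Implicit Arguments.
Unset Strict Implicit.
Unset Printing Implicit Defensive.

Import Order.TTheory GRing.Theory Num.Theory.
Import numFieldNormedType.Exports.

Local Open Scope classical_set_scope.
Local Open Scope ring_scope.

Section Scheduling.
Context {R : realType} {N : nat}.

(** Packet [i] has size [B i], arrival instant [ta i] and deadline [td i]; packet
    number k, with k in 1, ..., N, is the element k-1 of ['I_N]. *)
Implicit Types (B ta td : 'I_N -> R) (f r : R -> R) (P : R -> option 'I_N).

Definition lifetime ta td (i : 'I_N) : set R := `[ta i, td i].

(** The default value 0 of the iterated maximum plays no role when there is at
    least one packet and every deadline is positive. *)
Definition horizon td : R := \big[Num.max/0]_(i < N) td i.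

(** The strictly increasing sequence t_0 < t_1 < ... < t_M. *)
Definition instants ta td : seq R :=
  sort <=%R (undup ([seq ta i | i : 'I_N] ++ [seq td i | i : 'I_N])).

Definition instant ta td (j : nat) : R := nth 0 (instants ta td) j.

(** The number M of epochs: there are M + 1 instants. *)
Definition nepochs ta td : nat := (size (instants ta td)).-1.

(** Epochs are numbered from 1 to M. *)
Definition epoch ta td (j : nat) : set R :=
  `[instant ta td j.-1, instant ta td j].

Definition epoch_length ta td (j : nat) : R :=
  instant ta td j - instant ta td j.-1.

(** F_j *)
Definition transmittable ta td (j : nat) : {set 'I_N} :=
  [set i : 'I_N | `[< epoch ta td j `<=` lifetime ta td i >]]%SET.

(** [P t = None] means that the transmitter idles at [t]. Functions on [0, T]
    are total functions constrained on [0, T] only; measurability of [P] is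
    with respect to the discrete sigma-algebra on its finite codomain. *)
Record scheduler td P r : Prop := Scheduler {
  scheduler_measurable_packet :
    forall p : option 'I_N, measurable (`[0, horizon td] `&` P @^-1` [set p]);
  scheduler_measurable_rate : measurable_fun `[0, horizon td] r;
  scheduler_rate_ge0 : forall t, t \in `[0, horizon td] -> 0 <= r t;
  scheduler_idle : forall t, t \in `[0, horizon td] -> P t = None -> r t = 0 }.

Record feasible B ta td P r : Prop := Feasible {
  feasible_scheduler : scheduler td P r;
  feasible_lifetime : forall t i, t \in `[0, horizon td] ->
    P t = Some i -> lifetime ta td i t;
  feasible_complete : forall i : 'I_N,
    (\int[lebesgue_measure]_(t in lifetime ta td i `&` P @^-1` [set Some i])
       (r t)%:E = (B i)%:E)%E }.

(** tau_{i,j} *)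
Definition transmission_time ta td P (i : 'I_N) (j : nat) : \bar R :=
  lebesgue_measure (epoch ta td j `&` P @^-1` [set Some i]).

(** Psi_j, and below it its complement in F_j. *)
Definition active ta td P (j : nat) : {set 'I_N} :=
  [set i in transmittable ta td j | (0 < transmission_time ta td P i j)%E]%SET.

Definition inactive ta td P (j : nat) : {set 'I_N} :=
  [set i in transmittable ta td j | transmission_time ta td P i j == 0%E]%SET.

Definition energy td f r : \bar R :=
  (\int[lebesgue_measure]_(t in `[0%R, horizon td]) (f (r t))%:E)%E.

Definition optimal B ta td f P r : Prop :=
  feasible B ta td P r /\
  forall P' r', feasible B ta td P' r' -> (energy td f r <= energy td f r')%E.

End Scheduling.

(* Main.v *)
Require Import Defs.
From HB Require Import structures.
From mathcomp Require Import all_boot all_order all_algebra.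
From mathcomp Require Import all_classical all_reals all_analysis.
From mathcomp Require Import measurable_realfun ring lra zify.

Import Order.TTheory GRing.Theory Num.Theory.
Import numFieldNormedType.Exports.

Local Open Scope classical_set_scope.
Local Open Scope ring_scope.

(** Linear programming duality. For each rate x choose a subgradient l(x) of f
    at x, and let h(x) = f(x) - x l(x) be the intercept of the supporting line;
    h is nonincreasing. Write x(t) for the rate of the given scheduler. If some
    scheduler transmits packet i at rate y at time t, then (iii) gives
    r_i <= x(t), so f(y) >= h(r_i) + l(r_i) y >= h(x(t)) + l(r_i) y; when it
    idles, f(0) >= h(x(t)). Integrating, the energy of any feasible scheduler is
    at least the integral of h(x(t)) plus the sum of l(r_i) B_i, and the given
    scheduler attains this bound. *)

(** * Supporting lines of the power function *)

(** At [rho = 0] monotonicity lets slope 0 work. At [rho > 0] the slope is the supremum of the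
    slopes of chords ending at [rho] from the left; convexity bounds these by every chord slope to
    the right, and the chord from 0 makes the supremum nonnegative. *)
Lemma convex_nondecreasing_subgradient {R : realType} {f : R -> R} {rho : R} :
  convex_function (`[0, +oo[ : set R) f ->
  (forall x y, 0 <= x -> x <= y -> f x <= f y) -> 0 <= rho ->
  exists2 l, 0 <= l & forall x, 0 <= x -> f rho + l * (x - rho) <= f x.
Proof.
move=> cf ndf; rewrite le_eqVlt => /predU1P[<-|rho0].
  by exists 0 => // x x0; rewrite mul0r addr0; exact: ndf.
have chord y x : 0 <= y -> y < rho -> rho < x ->
    (f rho - f y) / (rho - y) <= (f x - f rho) / (x - rho).
  move=> y0 yrho rhox.
  (* This is the weight of [y] when [rho] is written as a convex combination of [y] and [x]. *)
  have t0 : 0 <= (x - rho) / (x - y) by rewrite divr_ge0//; lra.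
  have t1 : (x - rho) / (x - y) <= 1 by rewrite ler_pdivrMr; lra.
  have := cf (Itv01 t0 t1) y x.
  rewrite !inE/= !in_itv/= !andbT => /(_ y0 ltac:(lra)).
  rewrite !convRE /unstable.onem /=.
  set t := (x - rho) / (x - y).
  rewrite -[X in X <= _]/(f (t * y + (1 - t) * x)).
  rewrite -[X in _ <= X]/(t * f y + (1 - t) * f x).
  have -> : t * y + (1 - t) * x = rho by rewrite /t; field; lra.
  have -> : t * f y + (1 - t) * f x =
      ((x - rho) * f y + (rho - y) * f x) / (x - y) by rewrite /t; field; lra.
  rewrite ler_pdivlMr; last lra.
  rewrite ler_pdivrMr; last lra.
  rewrite mulrAC ler_pdivlMr; last lra.
  nra.
pose S := [set (f rho - f y) / (rho - y) | y in `[0, rho[].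
have S0 : S ((f rho - f 0) / (rho - 0)).
  by exists 0 => //; rewrite /= in_itv/= lexx.
have ubS x : rho < x -> ubound S ((f x - f rho) / (x - rho)).
  move=> rhox _ [y yI <-]; move: yI; rewrite /= in_itv/= => /andP[? ?].
  exact: chord.
have hasS : has_ubound S by exists ((f (rho + 1) - f rho) / (rho + 1 - rho));
  apply: ubS; lra.
exists (sup S).
  apply: le_trans (ub_le_sup hasS S0); rewrite divr_ge0// ?subr_ge0//.
    by apply: ndf => //; exact: ltW.
  exact: ltW.
move=> x x0; have [xrho|rhox|->] := ltgtP x rho.
- have Sx : S ((f rho - f x) / (rho - x)).
    by exists x => //; rewrite /= in_itv/= x0.
  have := ub_le_sup hasS Sx; rewrite ler_pdivrMr; last lra.
  nra.
- have := ge_sup (ex_intro _ _ S0) (ubS _ rhox); rewrite ler_pdivlMr; last lra.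
  nra.
- by rewrite subrr mulr0 addr0.
Qed.

(** * Sorted sequences and coverings up to a null set *)

(** Used to see that no arrival or deadline falls strictly inside an epoch: an entry below the one
    at [j] has an index below [j]. *)
Lemma sorted_le_nth_predn {R : realType} {s : seq R} {j : nat} {x : R} :
  sorted <=%R s -> (0 < j < size s)%N -> x \in s -> x < nth 0 s j ->
  x <= nth 0 s j.-1.
Proof.
move=> ss /andP[j0 js] xs; rewrite -{1 2}(nth_index 0 xs) => xj.
have is_ : (index x s < size s)%N by rewrite index_mem.
apply: le_sorted_leq_nth => //.
  by rewrite inE (leq_ltn_trans (leq_pred _)).
rewrite -ltnS prednK//; apply: contraTltn xj => jx; rewrite -leNgt.
exact: le_sorted_leq_nth.
Qed.

(** The union of the disjoint pieces has the full measure of [E]; as this measure is finite, it can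
    be subtracted, and the uncovered part is null. *)
Lemma finite_partition_ae {d} {T : measurableType d} {R : realType}
    (mu : {measure set T -> \bar R}) {I : finType} {F : {set I}}
    {E : set T} {A : I -> set T} :
  measurable E -> (mu E < +oo)%E ->
  (forall i, measurable (A i)) -> (forall i, A i `<=` E) ->
  trivIset setT A -> (\sum_(i in F) mu (A i))%E = mu E ->
  {ae mu, forall t, E t -> exists2 i, i \in F & A i t}.
Proof.
move=> mE Efin mA AE tA muA.
have mU : measurable (\bigcup_(i in [set` F]) A i).
  by apply: fin_bigcup_measurable => [|i _]; [exact: finite_finpred|exact: mA].
have UE : \bigcup_(i in [set` F]) A i `<=` E by move=> t [i _]; exact: AE.
exists (E `\` \bigcup_(i in [set` F]) A i); split.
- exact: measurableD.
- rewrite measureD// (_ : E `&` _ = \bigcup_(i in [set` F]) A i); last first.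
    exact: setIidr.
  rewrite measure_fin_bigcup//; last exact: sub_trivIset tA.
  rewrite -(bigfs _ (index_enum_uniq I)) => [|i _]; last first.
    by rewrite mem_index_enum.
  by rewrite -[X in (X - _)%E]muA subee// muA ge0_fin_numE.
- move=> t /not_implyP[Et nA]; split => // -[i Fi Ait]; exact: nA.
Qed.

(** * Instants and epochs *)

Lemma instants_sorted {R : realType} {N : nat} {ta td : 'I_N -> R} :
  sorted <=%R (instants ta td).
Proof. exact: sort_le_sorted. Qed.

Lemma mem_instants {R : realType} {N : nat} {ta td : 'I_N -> R} {x : R} :
  (x \in instants ta td) = (x \in codom ta) || (x \in codom td).
Proof. by rewrite /instants mem_sort mem_undup mem_cat. Qed.

Lemma le_horizon {R : realType} {N : nat} {td : 'I_N -> R} (i : 'I_N) :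
  td i <= horizon td.
Proof. exact: (le_bigmax 0 td i). Qed.

Lemma instants_itv {R : realType} {N : nat} {ta td : 'I_N -> R} {x : R} :
  (forall i, 0 <= ta i) -> (forall i, ta i < td i) ->
  x \in instants ta td -> x \in `[0, horizon td].
Proof.
move=> ta0 tatd; rewrite mem_instants in_itv/= => /orP[|] /codomP[i ->].
  by rewrite ta0 (le_trans (ltW (tatd i)))// le_horizon.
by rewrite le_horizon (le_trans (ta0 i))// ltW.
Qed.

(** The maximum is attained at a deadline: there is at least one packet, and no deadline lies below
    the default value 0. *)
Lemma horizon_instant {R : realType} {N : nat} {ta td : 'I_N -> R} :
  (0 < N)%N -> (forall i, 0 <= td i) -> horizon td \in instants ta td.
Proof.
move=> N0 td0; rewrite /horizon.
have [i _ ->] := @eq_bigmax _ _ _ 0 (Ordinal N0) xpredT td isT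
  (fun i _ => td0 i).
by rewrite mem_instants codom_f orbT.
Qed.

Lemma epoch_instants_itv {R : realType} {N : nat} {ta td : 'I_N -> R}
    {j : nat} :
  (1 <= j <= nepochs ta td)%N ->
  [/\ instant ta td j.-1 \in instants ta td, instant ta td j \in instants ta td
    & instant ta td j.-1 <= instant ta td j].
Proof.
rewrite /nepochs => /andP[j1 jM].
have js : (j < size (instants ta td))%N by lia.
have js' : (j.-1 < size (instants ta td))%N by lia.
split; try exact: mem_nth.
by apply: le_sorted_leq_nth => //; [exact: instants_sorted|exact: leq_pred].
Qed.

Lemma exists_epoch {R : realType} {N : nat} {ta td : 'I_N -> R} {t : R} :
  0 \in instants ta td -> horizon td \in instants ta td ->
  t \in `[0, horizon td] -> t \notin instants ta td ->
  exists2 j, (1 <= j <= nepochs ta td)%N &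
    instant ta td j.-1 < t < instant ta td j.
Proof.
move=> s0 sT; rewrite in_itv/= => /andP[t0 tT] ts.
set s := instants ta td.
have hasj : has (> t) s.
  apply/hasP; exists (horizon td) => //; rewrite lt_neqAle tT andbT.
  by apply: contraNneq ts => ->.
(* The epoch ends at the first instant after [t]; it is not the instant of index 0, because 0 is
   itself an instant and [t] is nonnegative. *)
pose j := find (> t) s.
have js : (j < size s)%N by rewrite -has_find.
have tj : t < nth 0 s j by exact: nth_find.
have j0 : (0 < j)%N.
  rewrite lt0n; apply: contraTneq tj => ->; rewrite -leNgt (le_trans _ t0)//.
  rewrite -[leRHS](nth_index 0 s0); apply: le_sorted_leq_nth => //.
  - exact: instants_sorted.
  - by rewrite inE (leq_ltn_trans _ js).
  - by rewrite inE index_mem.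
exists j; first by rewrite j0 /nepochs -/s -ltnS (leq_trans js)// leqSpred.
rewrite /instant -/s tj andbT lt_neqAle; apply/andP; split.
  by apply: contraNneq ts => <-; rewrite mem_nth// (leq_ltn_trans (leq_pred _)).
by rewrite leNgt; apply/negbT; apply: before_find; rewrite prednK.
Qed.

(** Both ends of a life time are instants, so neither can separate two points of an epoch's
    interior: one interior point in the life time brings in the whole epoch. *)
Lemma epoch_sub_lifetime {R : realType} {N : nat} {ta td : 'I_N -> R} {t : R}
    {i : 'I_N} {j : nat} :
  (1 <= j <= nepochs ta td)%N -> instant ta td j.-1 < t < instant ta td j ->
  lifetime ta td i t -> i \in transmittable ta td j.
Proof.
move=> jM /andP[jt tj]; rewrite /lifetime/= in_itv/= => /andP[ait tdi].
have js : (0 < j < size (instants ta td))%N by move: jM; rewrite /nepochs; lia.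
rewrite inE; apply/asboolP => u; rewrite /epoch /lifetime/= !in_itv/=.
move=> /andP[ju uj]; apply/andP; split.
- apply: le_trans ju; apply: sorted_le_nth_predn => //.
  + exact: instants_sorted.
  + by rewrite mem_instants codom_f.
  + exact: le_lt_trans tj.
- apply: (le_trans uj); rewrite leNgt; apply/negP => tdj.
  have : td i <= instant ta td j.-1.
    apply: sorted_le_nth_predn => //; first exact: instants_sorted.
    by rewrite mem_instants codom_f orbT.
  by rewrite leNgt (lt_le_trans jt tdi).
Qed.

(** * Integrals split by transmitted packet *)

(** On [D] the integrand is the finite sum of the [g i] restricted to the disjoint fibres of [p];
    measurability and the integral both follow from this. *)
Lemma ge0_integral_option {d} {T : measurableType d} {R : realType}
    (mu : {measure set T -> \bar R}) {I : finType} {D : set T}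
    {p : T -> option I} {g : I -> T -> R} :
  measurable D -> (forall i, measurable (D `&` p @^-1` [set Some i])) ->
  (forall i, measurable_fun D (g i)) -> (forall i t, D t -> 0 <= g i t) ->
  measurable_fun D (fun t => if p t is Some i then g i t else 0) /\
  (\int[mu]_(t in D) (if p t is Some i then g i t else 0)%:E =
   \sum_i \int[mu]_(t in D `&` p @^-1` [set Some i]) (g i t)%:E)%E.
Proof.
move=> mD mp mg g0; pose A i := D `&` p @^-1` [set Some i].
pose G i : T -> \bar R := (EFin \o g i) \_ (A i).
have wE t : t \in D -> (if p t is Some i then g i t else 0)%:E =
    (\sum_i G i t)%E.
  move=> /set_mem Dt; case E : (p t) => [i|].
    rewrite (bigD1 i)//= big1 => [|k ki].
      by rewrite adde0 /G patchT//; apply/mem_set.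
    rewrite /G patchN//; apply/negP => /set_mem[_] /=.
    by rewrite E => -[ik]; rewrite ik eqxx in ki.
  rewrite big1// => i _; rewrite /G patchN//; apply/negP => /set_mem[_] /=.
  by rewrite E.
have mG i : measurable_fun D (G i).
  apply/measurable_restrict => //; first exact: mp.
  by apply: measurable_funS (measurableT_comp _ (mg i)) => //; exact: subIsetl.
split.
  apply/measurable_EFinP.
  apply: (eq_measurable_fun (fun t => \sum_i G i t)%E).
    by move=> t tD; rewrite /= wE.
  exact: emeasurable_sum.
rewrite (eq_integral _ _ wE) ge0_integral_sum//.
  apply: eq_bigr => i _.
  by rewrite -integral_mkcondr /A setIA setIid.
move=> i t Dt; rewrite /G patchE; case: ifPn => // _; rewrite lee_fin; exact: g0.
Qed.

Lemma lifetime_sub {R : realType} {N : nat} {ta td : 'I_N -> R} (i : 'I_N) :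
  (forall i, 0 <= ta i) -> lifetime ta td i `<=` `[0, horizon td].
Proof.
move=> ta0 t; rewrite /lifetime/= !in_itv/= => /andP[it ti].
by rewrite (le_trans (ta0 i))// (le_trans ti)// le_horizon.
Qed.

Lemma feasible_preimage {R : realType} {N : nat} {B ta td : 'I_N -> R}
    {P : R -> option 'I_N} {r : R -> R} (i : 'I_N) :
  (forall i, 0 <= ta i) -> feasible B ta td P r ->
  lifetime ta td i `&` P @^-1` [set Some i] =
  `[0, horizon td] `&` P @^-1` [set Some i].
Proof.
move=> ta0 FP; apply/seteqP; split => t [? Pt]; split => //.
  exact: (lifetime_sub i ta0).
exact: (feasible_lifetime FP).
Qed.

(** With a price per unit of data that depends on the packet only, completeness fixes the total: it
    is the same for all feasible schedulers. *)
Lemma feasible_rate_integral {R : realType} {N : nat} {B ta td : 'I_N -> R}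
    {P : R -> option 'I_N} {r : R -> R} {l : 'I_N -> R} :
  (forall i, 0 <= ta i) -> (forall i, 0 <= l i) -> feasible B ta td P r ->
  measurable_fun (`[0, horizon td] : set R)
    (fun t => if P t is Some i then l i * r t else 0) /\
  (\int[lebesgue_measure]_(t in `[0%R, horizon td])
     (if P t is Some i then l i * r t else 0)%:E = (\sum_i l i * B i)%:E)%E.
Proof.
move=> ta0 l0 FP; have [mP mr r0 _] := feasible_scheduler FP.
have mlr i : measurable_fun `[0, horizon td] (fun t => l i * r t).
  exact: measurable_funM.
have lr0 i t : `[0, horizon td]%classic t -> 0 <= l i * r t.
  by move=> Dt; rewrite mulr_ge0// r0.
have [mw ->] := ge0_integral_option lebesgue_measure (measurable_itv _)
  (fun i => mP (Some i)) mlr lr0.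
split => //; rewrite -sumEFin; apply: eq_bigr => i _.
under eq_integral do rewrite EFinM.
rewrite ge0_integralZl_EFin//.
- by rewrite -(feasible_preimage i ta0 FP) (feasible_complete FP).
- exact: mP.
- by move=> t [Dt _]; rewrite lee_fin r0.
- apply/measurable_EFinP; apply: measurable_funS mr => //; exact: subIsetl.
Qed.

(** * Almost-everywhere properties and measurability *)

(** Non-idling makes the transmittable packets cover each epoch up to a null set. The finitely many
    instants, and the packets with zero transmission time in an epoch, add only null sets. *)
Lemma nonidling_active_ae {R : realType} {N : nat} {B ta td : 'I_N -> R}
    {P : R -> option 'I_N} {r : R -> R} :
  (0 < N)%N -> (forall i, 0 <= ta i) -> (exists i, ta i = 0) ->
  (forall i, ta i < td i) -> feasible B ta td P r ->
  (forall j : nat, (1 <= j <= nepochs ta td)%N ->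
     (\sum_(i in transmittable ta td j) transmission_time ta td P i j
      = (epoch_length ta td j)%:E)%E) ->
  {ae lebesgue_measure, forall t : R, t \in `[0, horizon td] ->
     exists j k, [/\ (1 <= j <= nepochs ta td)%N,
       instant ta td j.-1 < t < instant ta td j,
       k \in active ta td P j & P t = Some k]}.
Proof.
move=> N0 ta0 [i0 tai0] tatd FP ni.
have aeF := ae_filter_ringOfSetsType (@lebesgue_measure R).
have [mP _ _ _] := feasible_scheduler FP.
have T0 : forall i, 0 <= td i by move=> i; rewrite (le_trans (ta0 i))// ltW.
have ae_instants : {ae lebesgue_measure, forall t : R, t \notin instants ta td}.
  exists [set` instants ta td]; split.
  - exact/countable_measurable/finite_set_countable/finite_seq.
  - exact/countable_lebesgue_measure0/finite_set_countable/finite_seq.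
  - by move=> t /negP; rewrite negbK.
(* The index lives in a finite type so that the exceptional sets can be united; index 0 is no epoch,
   hence the guard. *)
have ae_epoch (j : 'I_(nepochs ta td).+1) : {ae lebesgue_measure, forall t : R,
    (1 <= j)%N -> epoch ta td j t ->
    exists2 k, k \in active ta td P j & P t = Some k}.
  have [j1|] := boolP (1 <= j)%N; last by move=> _; exact: aeW.
  have jM : (1 <= j <= nepochs ta td)%N by rewrite j1 -ltnS ltn_ord.
  have [s1 s2 s12] := epoch_instants_itv jM.
  have ED : epoch ta td j `<=` `[0, horizon td].
    have /= := instants_itv ta0 tatd s1; have /= := instants_itv ta0 tatd s2.
    rewrite !in_itv/= => /andP[_ ?] /andP[? _] t; rewrite /epoch/= !in_itv/=.
    by move=> /andP[? ?]; apply/andP; split; lra.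
  have mE : measurable (epoch ta td j) by exact: measurable_itv.
  have muE : lebesgue_measure (epoch ta td j) = (epoch_length ta td j)%:E.
    rewrite lebesgue_measure_itv/= lte_fin /epoch_length.
    by case: ltgtP s12 => // -> _; rewrite subrr.
  pose A i := epoch ta td j `&` P @^-1` [set Some i].
  have mA i : measurable (A i).
    rewrite /A -(setIidl ED) -setIA; exact: measurableI.
  have ae1 : {ae lebesgue_measure, forall t : R, epoch ta td j t ->
      exists2 i, i \in transmittable ta td j & A i t}.
    apply: finite_partition_ae => //.
    - by rewrite [X in (X < _)%E]muE ltry.
    - by move=> i; exact: subIsetl.
    - by move=> i k _ _ [t [[_ Pi] [_ Pk]]]; move: Pk; rewrite /= Pi => -[].
    - by rewrite [RHS]muE -ni.
  have ae2 : {ae lebesgue_measure, forall t : R, forall i, A i t ->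
      transmission_time ta td P i j != 0%E}.
    apply: filter_forall => i.
    have [z|_] := eqVneq (transmission_time ta td P i j) 0%E; last exact: aeW.
    exists (A i); split => //; first exact: mA.
    by move=> t /not_implyP[].
  apply: (filterS2 aeF _ ae1 ae2) => t h1 h2 _ /h1[i iF Ai].
  exists i; last by case: Ai.
  by rewrite inE iF/= lt0e (h2 _ Ai) measure_ge0.
apply: (filterS2 aeF _ ae_instants (filter_forall aeF ae_epoch)) => t ts h Dt.
have [j jM jt] : exists2 j, (1 <= j <= nepochs ta td)%N &
    instant ta td j.-1 < t < instant ta td j.
  apply: exists_epoch => //; last exact: horizon_instant.
  by rewrite mem_instants -tai0 codom_f.
have jM' : (j < (nepochs ta td).+1)%N by case/andP: jM.
have jt' : epoch ta td j t.
  by rewrite /epoch/= in_itv/=; case/andP: jt => /ltW -> /ltW ->.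
have [k ka Pt] := h (Ordinal jM') (proj1 (andP jM)) jt'.
by exists j, k.
Qed.

(** A negative rate contradicts [r t >= 0] wherever it is taken, so packet [i] would be sent on a
    null set only and deliver 0 instead of [B i > 0]. *)
Lemma constant_rate_ge0 {R : realType} {N : nat} {B ta td : 'I_N -> R}
    {P : R -> option 'I_N} {r : R -> R} {i : 'I_N} {c : R} :
  (forall i, 0 <= ta i) -> 0 < B i -> feasible B ta td P r ->
  {ae lebesgue_measure, forall t : R,
    t \in `[0, horizon td] -> P t = Some i -> r t = c} -> 0 <= c.
Proof.
move=> ta0 Bi0 FP rc; rewrite leNgt; apply/negP => c0.
have [mP mr r0 _] := feasible_scheduler FP.
have := feasible_complete FP i.
rewrite (feasible_preimage i ta0 FP) (ge0_ae_eq_integral (g := cst 0%E)).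
- by rewrite integral0 => -[]; move: Bi0 => /[swap] <-; rewrite ltxx.
- exact: mP.
- apply/measurable_EFinP; apply: measurable_funS mr => //; exact: subIsetl.
- exact: measurable_cst.
- by move=> t [Dt _]; rewrite lee_fin r0.
- by [].
- apply: (@filterS _ _ (ae_filter_ringOfSetsType lebesgue_measure) _ _ _ rc).
  move=> t h [Dt Pt]; have := r0 _ Dt.
  by rewrite (h Dt Pt) leNgt c0.
Qed.

(** Since [f] is monotone on nonnegative arguments only, it is first composed with [Num.max 0],
    which makes it monotone on the whole line. *)
Lemma measurable_nondecreasing_comp {d} {T : measurableType d} {R : realType}
    {D : set T} {f : R -> R} {r : T -> R} :
  measurable D -> (forall x y, 0 <= x -> x <= y -> f x <= f y) ->
  measurable_fun D r -> (forall t, D t -> 0 <= r t) ->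
  measurable_fun D (fun t => f (r t)).
Proof.
move=> mD ndf mr r0.
apply: (eq_measurable_fun ((fun x => f (Num.max 0 x)) \o r)).
  by move=> t /set_mem Dt; rewrite /= max_r// r0.
apply: measurableT_comp mr; apply: nondecreasing_measurable => // x y xy.
by apply: ndf; [rewrite le_max lexx|rewrite ge_max !le_max lexx xy orbT].
Qed.

(** * Optimality by duality *)

Theorem theorem1 (R : realType) (N : nat) (N_gt0 : (0 < N)%N)
    (B ta td : 'I_N -> R)
    (B_gt0 : forall i, 0 < B i)
    (ta_first : ta (Ordinal N_gt0) = 0)
    (ta_increasing : forall i j : 'I_N, (i < j)%N -> ta i < ta j)
    (ta_lt_td : forall i, ta i < td i)
    (f : R -> R)
    (f_ge0 : forall x, 0 <= x -> 0 <= f x)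
    (f_convex : convex_function (`[0, +oo[ : set R) f)
    (f_increasing : forall x y, 0 <= x -> x <= y -> f x <= f y)
    (P : R -> option 'I_N) (r : R -> R)
    (Pr_feasible : feasible B ta td P r)
    (rate : 'I_N -> R)
    (constant_rate : forall i : 'I_N, {ae lebesgue_measure, forall t : R,
       t \in `[0, horizon td] -> P t = Some i -> r t = rate i})
    (non_idling : forall j : nat, (1 <= j <= nepochs ta td)%N ->
       (\sum_(i in transmittable ta td j) transmission_time ta td P i j
        = (epoch_length ta td j)%:E)%E)
    (active_equal : forall j : nat, (1 <= j <= nepochs ta td)%N ->
       forall i k : 'I_N, i \in active ta td P j -> k \in active ta td P j ->
       rate i = rate k)
    (active_max : forall j : nat, (1 <= j <= nepochs ta td)%N ->
       forall i k : 'I_N, i \in active ta td P j -> k \in inactive ta td P j ->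
       rate k <= rate i) :
  optimal B ta td f P r.
Proof.
have ta0 i : 0 <= ta i.
  rewrite -ta_first; case: (posnP i) => [i0|i_gt0].
    by rewrite (_ : i = Ordinal N_gt0)//; exact: val_inj.
  by apply/ltW/ta_increasing.
split=> // P' r' Pr'_feasible.
have rate0 i : 0 <= rate i.
  exact: constant_rate_ge0 ta0 (B_gt0 i) Pr_feasible (constant_rate i).
have [l lP] : {l : R -> R & forall x, 0 <= x ->
    0 <= l x /\ forall y, 0 <= y -> f x + l x * (y - x) <= f y}.
  apply: (@choice _ _ (fun x m => 0 <= x ->
    0 <= m /\ forall y, 0 <= y -> f x + m * (y - x) <= f y)) => x.
  have [x0|_] := leP 0 x; last by exists 0.
  have [l l0 lx] :=
    convex_nondecreasing_subgradient f_convex f_increasing x0.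
  by exists l.
pose h x := f x - l x * x.
(* Evaluating each supporting line at the other point gives [l x <= l y]; the line at [y], evaluated
   at [x >= 0], then compares the intercepts. *)
have h_anti x y : 0 <= x -> x <= y -> h y <= h x.
  move=> x0 xy; have [_ lx] := lP _ x0; have [_ ly] := lP _ (le_trans x0 xy).
  move: (lx y (le_trans x0 xy)) (ly x x0); rewrite /h.
  have [->|xy' lxy lyx] := eqVneq x y; first by rewrite lexx.
  have {}xy : 0 < y - x by rewrite subr_gt0 lt_neqAle xy' xy.
  have : l x <= l y by rewrite -(ler_pM2r xy); lra.
  nra.
have l0 i : 0 <= l (rate i) by have [] := lP _ (rate0 i).
(* The intercepts h may be negative: adding the constant C to all powers keeps
   the integrands nonnegative. *)
pose C : R := \sum_i `|h (rate i)|.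
have C0 : 0 <= C by apply: sumr_ge0.
have hC i : 0 <= C + h (rate i).
  rewrite /C (bigD1 i)//= addrAC addr_ge0//; last exact: sumr_ge0.
  by rewrite -lerBlDr sub0r -normrN ler_norm.
have [[mP mr r0 _] [mP' mr' r'0 r'idle]] :=
  (feasible_scheduler Pr_feasible, feasible_scheduler Pr'_feasible).
set D := (`[0, horizon td]%classic : set R).
have mD : measurable D by exact: measurable_itv.
(* [K] prices time, always through the given scheduler; [W] and [W'] price the data sent by the
   given scheduler and by its rival. *)
pose K t := if P t is Some i then C + h (rate i) else 0.
pose W t := if P t is Some i then l (rate i) * r t else 0.
pose W' t := if P' t is Some i then l (rate i) * r' t else 0.
have mK : measurable_fun D K.
  by have [] := ge0_integral_option lebesgue_measure mD (fun i => mP (Some i))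
    (fun i => measurable_cst (C + h (rate i))) (fun i _ _ => hC i).
have [mW intW] := feasible_rate_integral ta0 l0 Pr_feasible.
have [mW' intW'] := feasible_rate_integral ta0 l0 Pr'_feasible.
have K0 t : 0 <= K t by rewrite /K; case: (P t).
have W0 t : D t -> 0 <= W t.
  by move=> Dt; rewrite /W; case: (P t) => // i; rewrite mulr_ge0// r0.
have W'0 t : D t -> 0 <= W' t.
  by move=> Dt; rewrite /W'; case: (P' t) => // i; rewrite mulr_ge0// r'0.
have split_integral (u v : R -> R) : measurable_fun D u -> measurable_fun D v ->
    (forall t, D t -> 0 <= u t) -> (forall t, D t -> 0 <= v t) ->
    (\int[lebesgue_measure]_(t in D) (u t + v t)%:E =
     \int[lebesgue_measure]_(t in D) (u t)%:E +
     \int[lebesgue_measure]_(t in D) (v t)%:E)%E.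
  move=> mu mv u0 v0; under eq_integral do rewrite EFinD.
  by rewrite ge0_integralD//; exact/measurable_EFinP.
(* Finiteness allows this term to be cancelled even if an energy is infinite. *)
have finC : (\int[lebesgue_measure]_(t in D) (cst C t)%:E)%E \is a fin_num.
  have -> : (\int[lebesgue_measure]_(t in D) (cst C t)%:E =
      C%:E * lebesgue_measure D)%E := integral_cst lebesgue_measure mD C%:E.
  by rewrite /D [X in (_ * X)%E]lebesgue_measure_itv/=; case: ifP.
have aeF := ae_filter_ringOfSetsType (@lebesgue_measure R).
(* The first inequality is in fact an equality, by the definition of [h]; the second is dual
   feasibility. *)
have key : {ae lebesgue_measure, forall t, D t ->
   f (r t) + C <= K t + W t /\ K t + W' t <= f (r' t) + C}.
  apply: (filterS2 aeF _ (filter_forall aeF constant_rate)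
    (nonidling_active_ae N_gt0 ta0 (ex_intro _ _ ta_first) ta_lt_td
       Pr_feasible non_idling)) => t rt act Dt.
  have [j [k [jM jt ka Pt]]] := act Dt.
  rewrite /K /W Pt (rt k Dt Pt); split; first by rewrite /h; lra.
  have [_ lk] := lP _ (rate0 k).
  (* If the rival idles, the supporting line at [rate k] is evaluated at rate 0. *)
  rewrite /W'; case P't : (P' t) => [i|]; last first.
    by have := lk _ (lexx 0); rewrite (r'idle t Dt P't) /h; lra.
  (* The rival's packet [i] is transmittable in epoch [j], so it is inactive, with a rate at most
     [rate k], or active, with the same rate. *)
  have rik : rate i <= rate k.
    have iF := epoch_sub_lifetime jM jt (feasible_lifetime Pr'_feasible Dt P't).
    have [z|nz] := eqVneq (transmission_time ta td P i j) 0%E.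
      by apply: active_max ka _ => //; rewrite inE iF z eqxx.
    by rewrite (active_equal j jM i k)// inE iF lt0e nz measure_ge0.
  have [_ li] := lP _ (rate0 i).
  move: (li _ (r'0 t Dt)) (h_anti _ _ (rate0 i) rik); rewrite /h; lra.
have intWW' : (\int[lebesgue_measure]_(t in D) (W' t)%:E =
    \int[lebesgue_measure]_(t in D) (W t)%:E)%E := etrans intW' (esym intW).
have intfC (s : R -> R) : measurable_fun D s -> (forall t, D t -> 0 <= s t) ->
    (energy td f s + \int[lebesgue_measure]_(t in D) (cst C t)%:E =
     \int[lebesgue_measure]_(t in D) (f (s t) + C)%:E)%E.
  move=> ms s0; rewrite split_integral//.
  - exact: measurable_nondecreasing_comp.
  - by move=> t Dt; rewrite f_ge0// s0.
have mfC (s : R -> R) : measurable_fun D s -> (forall t, D t -> 0 <= s t) ->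
    measurable_fun D (EFin \o (fun t => f (s t) + C)).
  move=> ms s0; apply/measurable_EFinP/measurable_funD => //.
  exact: measurable_nondecreasing_comp.
rewrite -(leeD2rE _ _ finC) !intfC//.
apply: (@le_trans _ _ (\int[lebesgue_measure]_(t in D) (K t + W t)%:E)%E).
  apply: ae_ge0_le_integral => //.
  - by move=> t Dt; rewrite lee_fin addr_ge0// f_ge0// r0.
  - exact: mfC.
  - by move=> t Dt; rewrite lee_fin addr_ge0// W0.
  - by apply/measurable_EFinP/measurable_funD.
  - by apply: (filterS _ key) => t le_t Dt; rewrite lee_fin; case: (le_t Dt).
(* Completeness exchanges the given scheduler's data term for the rival's, while [K] stays. *)
rewrite split_integral// -intWW' -split_integral//.
apply: ae_ge0_le_integral => //.
- by move=> t Dt; rewrite lee_fin addr_ge0// W'0.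
- by apply/measurable_EFinP/measurable_funD.
- by move=> t Dt; rewrite lee_fin addr_ge0// f_ge0// r'0.
- exact: mfC.
- by apply: (filterS _ key) => t le_t Dt; rewrite lee_fin; case: (le_t Dt).
Qed.
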